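(* Suppose Assumptions (A1)–(A3) hold. Let $a<1/U_L$ and $$\lambda:=\sqrt{\frac{8\sigma}{c\,a\,n^{2/3}}\big[\ln(n^{1/3}p)+\tilde\zeta\big]}.$$ Let $\hat\beta\in\mathbb R^p$ with $\|\hat\beta\|_\infty\le R$ satisfy S$^3$ONC$(\mathbf Z_1^n)$ almost surely. There are universal constants $\tilde c,C_3,C_4>0$ such that: (i) For any $\Gamma\ge0$, assume $$n>C_3\Big[\Big(\tfrac{\Gamma+\hat\varepsilon}{\sigma}\Big)^3+s\big(\ln(n^{1/3}p)+\tilde\zeta\big)\Big]$$ and assume $\mathcal L_{n,\lambda}(\hat\beta,\mathbf Z_1^n)\le\mathcal L_{n,\lambda}(\beta^*_{\hat\varepsilon},\mathbf Z_1^n)+\Gamma$ almost surely. Then, with probability at least $1-2(p+1)e^{-\tilde cn}-6e^{-2cn^{1/3}}$, $$\mathbb L(\hat\beta)-\mathbb L(\beta^* )\le C_3\sigma\Big[\tfrac{s(\ln(n^{1/3}p)+\tilde\zeta)}{n^{2/3}}+\sqrt{\tfrac{s(\ln(n^{1/3}p)+\tilde\zeta)}{n}}+\tfrac1{n^{1/3}}\Big]+C_3\sqrt{\tfrac{\sigma(\Gamma+\hat\varepsilon)}{n^{1/3}}}+\Gamma+\hat\varepsilon.$$ (ii) Assume $$n>C_4\Big(\tfrac{\hat\varepsilon}{\sigma}\Big)^3+C_4\,a^{-1}\big[\ln(n^{1/3}p)+\tilde\zeta\big]s^{3/2}R^{3/2}$$ and assume $\mathcal L_{n,\lambda}(\hat\beta,\mathbf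 Z_1^n)\le\mathcal L_{n,\lambda}(\hat\beta^{\ell_1},\mathbf Z_1^n)$ almost surely. Then, with probability at least $1-2(p+1)e^{-\tilde cn}-6e^{-2cn^{1/3}}$, $$\mathbb L(\hat\beta)-\mathbb L(\beta^* )\le C_4a^{-1/2}s\sigma\Big[\tfrac{\ln(n^{1/3}p)+\tilde\zeta}{n^{2/3}}+\tfrac{R\sqrt{\ln(n^{1/3}p)+\tilde\zeta}}{n^{1/3}}\Big]+C_4\sqrt{\tfrac{\sigma\hat\varepsilon}{n^{1/3}}}+\hat\varepsilon.$$
   Context: Standing setup. Let $Z_1,\dots,Z_n$ be i.i.d. random samples with support $\mathcal W\subseteq\mathbb R^q$, and write $\mathbf Z_1^n=(Z_1,\dots,Z_n)$. Let $L:\mathbb R^p\times\mathcal W\to\mathbb R$ (with $p>2$) be measurable and deterministic. Define $\mathcal L_n(\beta,\mathbf Z_1^n)=\frac1n\sum_{i=1}^nL(\beta,Z_i)$ and $\mathbb L(\beta)=\mathbb E[\mathcal L_n(\beta,\mathbf Z_1^n)]$. Let $\beta^*\in\arg\min_{\beta\in\mathbb R^p}\mathbb L(\beta)$, with $\|\beta^*\|_\infty\le R$ for some $R\ge1$. Assume $L(\cdot,z)$ is continuously differentiable for a.e. $z$, with coordinatewise Lipschitz partial derivatives of constant $U_L\ge1$: $$\Big|\partial_{\beta_j}\mathcal L_n(\tilde\beta+\delta e_j,z)-\partial_{\beta_j}\mathcal L_n(\tilde\beta,z)\Big|\le U_L|\delta|\quad\text{for all }\tilde\beta,\ \delta,\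 j,\ \text{a.e. } z.$$ Penalty. For $\lambda,a>0$, $P_\lambda(\theta)=\int_0^\theta\frac{[a\lambda-t]_+}{a}\,dt$ ($\theta\ge0$), and $\mathcal L_{n,\lambda}(\beta,\mathbf Z_1^n)=\mathcal L_n(\beta,\mathbf Z_1^n)+\sum_jP_\lambda(|\beta_j|)$. Notation. $|\cdot|$ on vectors is the $\ell_1$ norm, $\|\cdot\|$ is the Euclidean norm, and $\|\cdot\|_0$ counts nonzero entries. (A1) (A-sparsity). There is $\beta^*_{\hat\varepsilon}$ with $\|\beta^*_{\hat\varepsilon}\|_\infty\le R$, $s:=\|\beta^*_{\hat\varepsilon}\|_0\ge1$ and $\mathbb L(\beta^*_{\hat\varepsilon})-\mathbb L(\beta^* )\le\hat\varepsilon$, for some $\hat\varepsilon\ge0$. (A2). For every $\beta$, the variables $L(\beta,Z_i)-\mathbb EL(\beta,Z_i)$ are independent and sub-exponential with $\psi_1$-norm $\le\sigma$ ($\sigma\ge1$). Hence there is an absolute constant $c\in(0,0.5]$ with $$\mathbb P\Big(\Big|\sum_ia_i\{L(\beta,Z_i)-\mathbb EL(\beta,Z_i)\}\Big|>\sigma(\|\mathbf a\|\sqrt t+\|\mathbf a\|_\infty t)\Big)\le 2e^{-ct}\quad\text{for all } t\ge0,\ \mathbf a\in\mathbb R^n.$$ (A3). There is a measurable deterministic $\mathcal C:\mathcal W\to\mathbb R_+$ with $\|\mathcal C(Z_i)-\mathbb E\mathcal C(Z_i)\|_{\psi_1}\le\sigma_L$ ($\sigma_L\ge1$), $\mathbb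 E|\mathcal C(Z_i)|\le\mathcal C_\mu$ ($\mathcal C_\mu\ge1$), and $|L(\beta_1,z)-L(\beta_2,z)|\le\mathcal C(z)\|\beta_1-\beta_2\|$ for all $\beta_1,\beta_2$ and a.e. $z$. S$^3$ONC. A vector $\hat\beta$ satisfies S$^3$ONC$(\mathbf Z_1^n)$ if both of the following hold. (a) There exist $g_j$, with $g_j=P_\lambda'(|\hat\beta_j|)\operatorname{sign}(\hat\beta_j)$ if $\hat\beta_j\ne0$ and $g_j\in[-\lambda,\lambda]$ if $\hat\beta_j=0$, such that $\partial_{\beta_j}\mathcal L_n(\hat\beta,\mathbf Z_1^n)+g_j=0$ for all $j$. (b) For every $j$ with $|\hat\beta_j|\in(0,a\lambda)$, $U_L+P_\lambda''(|\hat\beta_j|)\ge0$. Further notation. $\tilde\zeta:=\ln(3eR(\sigma_L+\mathcal C_\mu))$, and $\hat\beta^{\ell_1}\in\arg\min_\beta\{\mathcal L_n(\beta,\mathbf Z_1^n)+\lambda|\beta|\}$. *)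

(* Defs.v *)
From HB Require Import structures.
From mathcomp Require Import all_boot all_order all_algebra.
From mathcomp Require Import all_classical all_reals all_analysis.
Set Implicit Arguments. Unset Strict Implicit. Unset Printing Implicit Defensive.
Import Order.TTheory GRing.Theory Num.Theory.
Import numFieldNormedType.Exports.
Local Open Scope classical_set_scope.
Local Open Scope ring_scope.

Section Defs.
Variable R : realType.

Definition l1norm p (b : 'rV[R]_p) : R := \sum_(j < p) `|b ord0 j|.
Definition l2norm p (b : 'rV[R]_p) : R := Num.sqrt (\sum_(j < p) (b ord0 j) ^+ 2).
Definition linfnorm p (b : 'rV[R]_p) : R := \big[Num.max/0]_(j < p) `|b ord0 j|.
Definition l0norm p (b : 'rV[R]_p) : nat := #|[set j : 'I_p | b ord0 j != 0]|.
Definition evec p (j : 'I_p) : 'rV[R]_p := delta_mx 0 j.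

Definition vnorm2 n (a : 'I_n -> R) : R := Num.sqrt (\sum_(i < n) (a i) ^+ 2).
Definition vnorminf n (a : 'I_n -> R) : R := \big[Num.max/0]_(i < n) `|a i|.

Definition C1fun p (f : 'rV[R]_p -> R) : Prop :=
  (forall x, differentiable f x) /\ (forall v, continuous (fun x => 'D_v f x)).

Definition pen (a lam : R) (theta : R) : R :=
  Rintegral lebesgue_measure `[0, theta]%classic
    (fun t => Num.max (a * lam - t) 0 / a).
Definition pen_sum p (a lam : R) (b : 'rV[R]_p) : R :=
  \sum_(j < p) pen a lam `|b ord0 j|.

Definition S3ONC p (a lam UL : R) (f : 'rV[R]_p -> R) (b : 'rV[R]_p) : Prop :=
  (forall j : 'I_p,
     (b ord0 j != 0 ->
        'D_(evec j) f b + (derive1 (pen a lam)) `|b ord0 j| * Num.sg (b ord0 j) = 0)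
     /\ (b ord0 j = 0 ->
        exists g : R, - lam <= g <= lam /\ 'D_(evec j) f b + g = 0))
  /\ (forall j : 'I_p, 0 < `|b ord0 j| < a * lam ->
        0 <= UL + (derive1 (derive1 (pen a lam))) `|b ord0 j|).

Section Prob.
Context {d : measure_display} {T : measurableType d} (P : probability T R).

Definition indep_family {dV : measure_display} {V : measurableType dV} n
    (X : 'I_n -> T -> V) : Prop :=
  forall A : 'I_n -> set V, (forall i, measurable (A i)) ->
    P (\bigcap_(i in [set: 'I_n]) (X i @^-1` A i)) =
    (\prod_(i < n) P (X i @^-1` A i))%E.

Definition ident_distr {dV : measure_display} {V : measurableType dV} n
    (X : 'I_n -> T -> V) : Prop :=
  forall i j (A : set V), measurable A -> P (X i @^-1` A) = P (X j @^-1` A).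

(** ||X||_{psi_1} <= K  (Orlicz norm: inf{t > 0 : E exp(|X|/t) <= 2} <= K). *)
Definition psi1_le (X : T -> R) (K : R) : Prop :=
  forall t, K < t -> ('E_P[fun w => expR (`|X w| / t)] <= 2%:E)%E.

(** The Bernstein-type tail bound with constant c for independent centred
    sub-exponential variables (the "absolute constant c" of (A2)). *)
Definition bernstein_const (c : R) : Prop :=
  forall m (X : 'I_m -> T -> R) (K : R), 0 < K ->
    (forall i, measurable_fun setT (X i)) -> indep_family X ->
    (forall i, P.-integrable setT (fun w => (X i w)%:E)) ->
    (forall i, ('E_P[X i] = 0)%E) -> (forall i, psi1_le (X i) K) ->
    forall (a : 'I_m -> R) (t : R), 0 <= t ->
      (P [set w | (K * (vnorm2 a * Num.sqrt t + vnorminf a * t)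
                  < `|\sum_(i < m) a i * X i w|)%R ]
        <= (2 * expR (- (c * t)))%:E)%E.

Definition emp_loss {dW : measure_display} {W : measurableType dW} n p
    (Z : 'I_n -> T -> W) (L : 'rV[R]_p -> W -> R) (b : 'rV[R]_p) (w : T) : R :=
  (n%:R)^-1 * \sum_(i < n) L b (Z i w).
Definition pop_loss {dW : measure_display} {W : measurableType dW} n p
    (Z : 'I_n -> T -> W) (L : 'rV[R]_p -> W -> R) (b : 'rV[R]_p) : R :=
  (n%:R)^-1 * \sum_(i < n) fine ('E_P[fun w => L b (Z i w)])%E.
Definition pen_loss {dW : measure_display} {W : measurableType dW} n p
    (Z : 'I_n -> T -> W) (L : 'rV[R]_p -> W -> R) (a lam : R)
    (b : 'rV[R]_p) (w : T) : R :=
  emp_loss Z L b w + pen_sum a lam b.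
End Prob.
End Defs.
Arguments evec {R p} j.

(* Main.v *)
Require Import Defs.
From HB Require Import structures.
From mathcomp Require Import all_boot all_order all_algebra.
From mathcomp Require Import all_classical all_reals all_analysis.
From mathcomp Require Import measurable_realfun.
From mathcomp Require Import ring lra.
Set Implicit Arguments.
Unset Strict Implicit.
Unset Printing Implicit Defensive.
Import Order.TTheory GRing.Theory Num.Theory.
Import numFieldNormedType.Exports.
Local Open Scope classical_set_scope.
Local Open Scope ring_scope.

(** The second-order condition (b) and [a < 1 / UL] exclude entries of [betahat] in
    [(0, a lam)], so each nonzero entry costs the full penalty
    [a lam ^ 2 / 2 = 4 sigma zeta / (c n ^ (2/3))], where [zeta] is [logt].  A union bound over a
    grid, with Bernstein level [2 k zeta / c + 2 n ^ (1/3)] at grid points with [k] nonzero entries,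
    bounds the deviation of the empirical loss, simultaneously for all [b] of sup norm at
    most [R0].  With [k] the number of nonzero entries of [b], AM-GM applied to
    [sqrt (k zeta / n)] makes this deviation at most [3 k sigma zeta / (c n ^ (2/3))] plus a
    multiple of [sigma / n ^ (1/3)].  The penalty at [betahat] absorbs the first term, so the
    number of nonzero entries of [betahat] never has to be estimated.  In (ii) the l1 solution
    is compared with [beta_eps] through [pen theta <= lam theta]. *)

(** * The penalty and the thresholding of S3ONC points *)

Lemma pen0 (R : realType) (a lam : R) : pen a lam 0 = 0.
Proof. by rewrite /pen set_itv1 Rintegral_set1. Qed.

(** On [[0, a * lam]] the positive part in the integrand is inactive, so [pen] integrates a linear
    function with primitive [F]. *)
Lemma pen_quadratic (R : realType) (a lam th : R) : 0 < a -> 0 <= th <= a * lam ->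
  pen a lam th = lam * th - th ^+ 2 / (2 * a).
Proof.
move=> a0 /andP[]; rewrite le_eqVlt => /predU1P[<- _|th0 thal].
  (* The point [th = 0] is split off because [continuous_FTC2] requires a nondegenerate interval. *)
  by rewrite pen0 mulr0 expr0n /= mul0r subr0.
have a0' : a != 0 by rewrite gt_eqF.
pose F := fun x : R => lam * x - x ^+ 2 / (2 * a).
have Fd (x : R) : is_derive x 1 F (lam - x / a).
  apply: is_derive_eq; rewrite /GRing.scale /=; by field.
rewrite /pen; transitivity (Rintegral lebesgue_measure `[0, th]%classic (fun t => lam - t / a)).
  apply: eq_Rintegral => t; rewrite inE /= in_itv /= => /andP[t0 tth].
  rewrite max_l; last by rewrite subr_ge0 (le_trans tth).
  by field.
have Fc : continuous F by move=> x; apply/differentiable_continuous/derivable1_diffP.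
rewrite /Rintegral (@continuous_FTC2 _ _ F) //=.
- by rewrite /F mulr0 expr0n /= mul0r subr0 subr0.
- apply: continuous_subspaceT => x.
  by apply: cvgB; [exact: cvg_cst|apply: cvgMr_tmp; exact: cvg_id].
- split => //.
  + by apply/cvg_at_right_filter/Fc.
  + by apply/cvg_at_left_filter/Fc.
- by move=> x _; rewrite derive1E; exact: derive_val.
Qed.

Lemma pen_flat (R : realType) (a lam th : R) : 0 < a -> 0 <= lam -> a * lam <= th ->
  pen a lam th = a * lam ^+ 2 / 2.
Proof.
move=> a0 lam0 alth.
have al0 : 0 <= a * lam by rewrite mulr_ge0 // ltW.
transitivity (pen a lam (a * lam)); last first.
  by rewrite pen_quadratic ?lexx ?andbT //; field; rewrite gt_eqF.
(* Both integrals are extended to the whole line; past [a * lam] both integrands vanish. *)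
rewrite /pen Rintegral_mkcond [RHS]Rintegral_mkcond; apply: eq_Rintegral => t _.
rewrite !patchE !mem_setE !in_itv /=.
have [t0|//] := leP 0 t; rewrite /=.
have [tal|alt] := leP t (a * lam); first by rewrite (le_trans tal).
by rewrite max_r ?mul0r ?if_same // subr_le0 ltW.
Qed.

Lemma pen_le_flat (R : realType) (a lam th : R) : 0 < a -> 0 <= lam -> 0 <= th ->
  pen a lam th <= a * lam ^+ 2 / 2.
Proof.
move=> a0 lam0 th0; have [thal|/ltW alth] := leP th (a * lam); last by rewrite pen_flat.
rewrite pen_quadratic ?th0 // -subr_ge0.
have -> : a * lam ^+ 2 / 2 - (lam * th - th ^+ 2 / (2 * a)) = (a * lam - th) ^+ 2 / (2 * a).
  by field; rewrite gt_eqF.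
by rewrite divr_ge0 ?sqr_ge0 // mulr_ge0 // ltW.
Qed.

Lemma pen_le_linear (R : realType) (a lam th : R) : 0 < a -> 0 <= lam -> 0 <= th ->
  pen a lam th <= lam * th.
Proof.
move=> a0 lam0 th0; have [thal|/ltW alth] := leP th (a * lam); last first.
  rewrite pen_flat //; have : lam * (a * lam) <= lam * th by rewrite ler_wpM2l.
  have : 0 <= a * lam ^+ 2 by rewrite mulr_ge0 ?sqr_ge0 // ltW.
  lra.
by rewrite pen_quadratic ?th0 // gerBl divr_ge0 ?sqr_ge0 // mulr_ge0 // ltW.
Qed.

(** Derivatives are local and [(0, a * lam)] is open, so [pen] can be replaced by its quadratic
    formula near each point, once for each derivative. *)
Lemma pen_derive2 (R : realType) (a lam th : R) : 0 < a -> 0 < th < a * lam ->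
  derive1 (derive1 (pen a lam)) th = - a^-1.
Proof.
move=> a0 thal.
have nearE (x : R) : 0 < x < a * lam -> \forall y \near x, 0 < y < a * lam.
  move=> xal; have : x \in `]0, a * lam[ by rewrite in_itv.
  by move/near_in_itvoo; apply: filterS => y; rewrite in_itv.
have D1 (x : R) : 0 < x < a * lam -> derive1 (pen a lam) x = lam - x / a.
  move=> /nearE xal; rewrite derive1E.
  rewrite (@near_eq_derive _ _ _ _ (fun x : R => lam * x - x ^+ 2 / (2 * a))); last first.
    by apply: filterS xal => y /andP[/ltW y0 /ltW yal]; rewrite pen_quadratic // y0.
  have Fd : is_derive x 1 (fun x : R => lam * x - x ^+ 2 / (2 * a)) (lam - x / a).
    by apply: is_derive_eq; rewrite /GRing.scale /=; field; rewrite gt_eqF.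
  exact: derive_val.
rewrite derive1E (@near_eq_derive _ _ _ _ (fun x : R => lam - x / a)); last first.
  by apply: filterS (nearE _ thal) => y /D1.
have Fd : is_derive th 1 (fun x : R => lam - x / a) (- a^-1).
  by apply: is_derive_eq; rewrite /GRing.scale /=; field; rewrite gt_eqF.
exact: derive_val.
Qed.

(** Inside [(0, a * lam)] the penalty has second derivative [- a^-1 < - UL], which violates the
    second-order condition. *)
Lemma S3ONC_threshold (R : realType) p (a lam UL : R) f (b : 'rV[R]_p) :
  0 < a -> a < UL^-1 -> 0 < UL -> S3ONC a lam UL f b ->
  forall j, b ord0 j != 0 -> a * lam <= `|b ord0 j|.
Proof.
move=> a0 aUL UL0 [_ H] j bj; rewrite leNgt; apply/negP => blt.
have bj' : 0 < `|b ord0 j| < a * lam by rewrite normr_gt0 bj.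
have := H j bj'; rewrite pen_derive2 // subr_ge0 leNgt => /negP; apply.
by rewrite -[UL]invrK ltf_pV2 ?posrE ?invr_gt0.
Qed.

(* The comprehension in [l0norm] denotes a classical set, to which [cardsE] does not apply. *)
Lemma l0normE (R : realType) p (b : 'rV[R]_p) : l0norm b = #|[pred j | b ord0 j != 0]|.
Proof. by apply: eq_card => j; apply/idP/idP; rewrite !inE. Qed.

Lemma pen_sum_thresholded (R : realType) p (a lam : R) (b : 'rV[R]_p) :
  0 < a -> 0 <= lam -> (forall j, b ord0 j != 0 -> a * lam <= `|b ord0 j|) ->
  pen_sum a lam b = (l0norm b)%:R * (a * lam ^+ 2 / 2).
Proof.
move=> a0 lam0 bE; rewrite /pen_sum l0normE.
rewrite (bigID (fun j => b ord0 j != 0)) /= [X in _ + X]big1 ?addr0; last first.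
  by move=> j; rewrite negbK => /eqP ->; rewrite normr0 pen0.
rewrite (eq_bigr (fun=> a * lam ^+ 2 / 2)); last by move=> j /bE; exact: pen_flat.
by rewrite sumr_const mulr_natl.
Qed.

Lemma pen_sum_le_l0norm (R : realType) p (a lam : R) (b : 'rV[R]_p) :
  0 < a -> 0 <= lam -> pen_sum a lam b <= (l0norm b)%:R * (a * lam ^+ 2 / 2).
Proof.
move=> a0 lam0; rewrite /pen_sum l0normE.
rewrite (bigID (fun j => b ord0 j != 0)) /= [X in _ + X]big1 ?addr0; last first.
  by move=> j; rewrite negbK => /eqP ->; rewrite normr0 pen0.
apply: (@le_trans _ _ (\sum_(j | b ord0 j != 0) (a * lam ^+ 2 / 2))).
  by apply: ler_sum => j _; exact: pen_le_flat.
by rewrite sumr_const mulr_natl.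
Qed.

Lemma pen_sum_le_l1norm (R : realType) p (a lam : R) (b : 'rV[R]_p) :
  0 < a -> 0 <= lam -> pen_sum a lam b <= lam * l1norm b.
Proof.
by move=> a0 lam0; rewrite /pen_sum /l1norm mulr_sumr; apply: ler_sum => j _; exact: pen_le_linear.
Qed.

(** * Comparison of vector norms *)

Lemma le_linfnorm (R : realType) p (b : 'rV[R]_p) j : `|b ord0 j| <= linfnorm b.
Proof. by rewrite /linfnorm; exact: (le_bigmax _ (fun j => `|b ord0 j|)). Qed.

Lemma l1norm_le_l0norm (R : realType) p (b : 'rV[R]_p) :
  l1norm b <= (l0norm b)%:R * linfnorm b.
Proof.
rewrite /l1norm l0normE (bigID (fun j => b ord0 j != 0)) /= [X in _ + X]big1 ?addr0; last first.
  by move=> j; rewrite negbK => /eqP ->; rewrite normr0.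
apply: (@le_trans _ _ (\sum_(j | b ord0 j != 0) linfnorm b)).
  by apply: ler_sum => j _; exact: le_linfnorm.
by rewrite sumr_const mulr_natl.
Qed.

Lemma l2norm_le_l1norm (R : realType) p (b : 'rV[R]_p) : l2norm b <= l1norm b.
Proof.
rewrite /l2norm -[leRHS]ger0_norm ?sumr_ge0 // -sqrtr_sqr ler_wsqrtr //.
rewrite /l1norm expr2 mulr_suml; apply: ler_sum => j _.
rewrite -real_normK ?num_real // expr2 ler_wpM2l //.
by rewrite (bigD1 j) //= lerDl sumr_ge0.
Qed.

(** * A finite grid, counted by support size *)

Definition grid_point (R : realType) p (N : nat) (delta : R)
    (g : {ffun 'I_p -> 'I_(N.*2.+1)}) : 'rV[R]_p :=
  \row_j (delta * ((g j)%:R - N%:R)).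

(** Index [N] encodes the coordinate value zero. *)
Lemma l0norm_grid_point (R : realType) p N (delta : R) (g : {ffun 'I_p -> 'I_(N.*2.+1)}) :
  delta != 0 -> l0norm (grid_point delta g) = #|[pred j | g j != N :> nat]|.
Proof.
move=> d0; rewrite l0normE; apply: eq_card => j.
by rewrite !inE mxE mulf_eq0 (negbTE d0) subr_eq0 eqr_nat.
Qed.

(** The sum factorises over coordinates: index [N] contributes [1] and each of the other [2 N]
    indices contributes [y]. This evaluates the total failure probability in the union bound. *)
Lemma sum_exp_l0norm_grid_point (R : realType) p N (delta y : R) : delta != 0 ->
  \sum_(g : {ffun 'I_p -> 'I_(N.*2.+1)}) y ^+ l0norm (grid_point delta g)
  = (1 + N.*2%:R * y) ^+ p.
Proof.
move=> d0; have Nlt : (N < N.*2.+1)%N by rewrite ltnS -addnn leq_addr.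
transitivity (\prod_(j < p) \sum_(m < N.*2.+1) (if m != N :> nat then y else 1)); last first.
  rewrite prodr_const card_ord; congr (_ ^+ _).
  rewrite (bigD1 (Ordinal Nlt)) //= eqxx /=; congr (_ + _).
  rewrite (eq_bigr (fun=> y)); last by move=> m mN; rewrite ifT.
  by rewrite sumr_const cardC1 card_ord mulr_natl.
rewrite bigA_distr_bigA; apply: eq_bigr => g _.
by rewrite -big_mkcond prodr_const l0norm_grid_point.
Qed.

(* Rounding every coordinate towards zero keeps the support. *)
Lemma grid_point_near (R : realType) p N (delta : R) (b : 'rV[R]_p) :
  0 < delta -> linfnorm b < N.+1%:R * delta ->
  exists g : {ffun 'I_p -> 'I_(N.*2.+1)},
    (l0norm (grid_point delta g) <= l0norm b)%N
    /\ l2norm (b - grid_point delta g) <= p%:R * delta.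
Proof.
move=> d0 bN.
pose m j := Num.truncn (`|b ord0 j| / delta).
have mitv j : (m j)%:R * delta <= `|b ord0 j| < (m j).+1%:R * delta.
  rewrite -ler_pdivlMr // -ltr_pdivrMr //.
  by apply: truncn_itv; rewrite divr_ge0 // ltW.
have mN j : (m j <= N)%N.
  rewrite -ltnS -(ltr_nat R) -(ltr_pM2r d0).
  have /andP[le_m _] := mitv j.
  by apply: le_lt_trans bN; apply: le_trans le_m _; exact: le_linfnorm.
(* The truncated subtraction [N - m j] is exact thanks to [mN]. *)
pose v j : nat := if 0 <= b ord0 j then (N + m j)%N else (N - m j)%N.
have vlt j : (v j < N.*2.+1)%N.
  rewrite ltnS /v -addnn; case: ifP => _; first by rewrite leq_add2l.
  by rewrite (leq_trans (leq_subr _ _)) ?leq_addr.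
exists [ffun j => Ordinal (vlt j)]; split.
  rewrite l0norm_grid_point ?gt_eqF // l0normE; apply/subset_leq_card/fintype.subsetP => j.
  rewrite !inE ffunE /= /v; apply: contra => /eqP bj.
  by rewrite bj lexx /m bj normr0 mul0r truncn0 addn0.
apply: le_trans (l2norm_le_l1norm _) _; rewrite /l1norm.
apply: (@le_trans _ _ (\sum_(j < p) delta)); last by rewrite sumr_const card_ord mulr_natl.
apply: ler_sum => j _; rewrite !mxE ffunE /= /v.
have := mitv j; rewrite -natr1 mulrDl mul1r.
have [bj|bj] := leP 0 (b ord0 j).
  rewrite ger0_norm // => /andP[h1 h2].
  rewrite natrD (_ : N%:R + (m j)%:R - N%:R = (m j)%:R :> R); last by ring.
  rewrite ler_norml; apply/andP; split; lra.
rewrite ltr0_norm // => /andP[h1 h2].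
rewrite natrB // (_ : N%:R - (m j)%:R - N%:R = - (m j)%:R :> R); last by ring.
rewrite ler_norml; apply/andP; split; lra.
Qed.

(** * Union bound and Bernstein tail for empirical means *)

Section empirical_process.
Context (R : realType) (d : measure_display) (T : measurableType d) (P : probability T R).

(** The bounds [B i] may vary with [i], so that grid points with larger support can receive smaller
    failure probabilities. *)
Lemma finite_union_bound (I : finType) (A : I -> set T) (B : I -> R) :
  (forall i, measurable (A i)) -> (forall i, (P (A i) <= (B i)%:E)%E) ->
  exists U : set T, [/\ measurable U, (P U <= (\sum_i B i)%:E)%E
    & forall i, A i `<=` U].
Proof.
move=> mA PA; exists (\big[setU/set0]_(i : I) A i); split.
- exact: bigsetU_measurable.
(* Measurability of the partial unions is carried through the induction, as subadditivity requires
   it at each step. *)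
- have : measurable (\big[setU/set0]_(i : I) A i)
    /\ (P (\big[setU/set0]_(i : I) A i) <= (\sum_i B i)%:E)%E.
    elim/big_rec2 : _ => [|i U y _ [mU PU]]; first by rewrite measure0.
    split; first exact: measurableU.
    by apply: (le_trans (measureU2 _ (mA i) mU)); rewrite EFinD; apply: leeD; first exact: PA.
  by case.
- by move=> i w Aw; rewrite -bigcup_seq; exists i => //=; rewrite mem_index_enum.
Qed.

Lemma indep_family_comp {dV dW : measure_display} {V : measurableType dV}
    {W : measurableType dW} n (X : 'I_n -> T -> V) (f : 'I_n -> V -> W) :
  indep_family P X -> (forall i, measurable_fun setT (f i)) ->
  indep_family P (fun i => f i \o X i).
Proof.
move=> iX mf A mA; rewrite -(iX (fun i => f i @^-1` A i)) //.
by move=> i; rewrite -[X in measurable X]setTI; exact: mf.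
Qed.

Lemma vnorm2_const n (x : R) : 0 <= x -> vnorm2 (fun _ : 'I_n => x) = Num.sqrt n%:R * x.
Proof.
move=> x0; rewrite /vnorm2 sumr_const card_ord -[_ ^+ 2 *+ n]mulr_natl sqrtrM //.
by rewrite sqrtr_sqr ger0_norm.
Qed.

Lemma vnorminf_const n (x : R) : (0 < n)%N -> 0 <= x -> vnorminf (fun _ : 'I_n => x) = x.
Proof.
move=> n0 x0; apply/le_anti/andP; split.
  by apply: bigmax_le => // i _; rewrite ger0_norm.
by rewrite -{1}(ger0_norm x0); exact: (le_bigmax _ (fun _ : 'I_n => `|x|) (Ordinal n0)).
Qed.

Lemma expectation_integral (X : T -> R) : ('E_P[X] = \int[P]_w (X w)%:E)%E.
Proof. by rewrite unlock. Qed.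

Lemma expectation_centered (X : T -> R) : P.-integrable setT (EFin \o X) ->
  P.-integrable setT (EFin \o (fun w => X w - fine ('E_P[X])%E))
  /\ ('E_P[fun w => (X w - fine ('E_P[X])%E)%R] = 0)%E.
Proof.
move=> iX; have iC := finite_measure_integrable_cst P (fine ('E_P[X])%E) measurableT.
split.
  by have := integrableB measurableT iX iC; apply: eq_integrable.
rewrite expectation_integral; under eq_integral do rewrite EFinB.
rewrite integralB_EFin //= integral_cst //= probability_setT mule1.
have EX : (\int[P]_w (X w)%:E)%E \is a fin_num by exact: integrable_fin_num.
by rewrite expectation_integral fineK // subee.
Qed.

Context (dW : measure_display) (W : measurableType dW) (n : nat) (Z : 'I_n -> T -> W).
Hypotheses (mZ : forall i, measurable_fun setT (Z i)) (iZ : indep_family P Z).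
Hypothesis n0 : (0 < n)%N.
Context (c : R).
Hypothesis bern : bernstein_const P c.

(** For [f := L b] these unfold to [emp_loss] and [pop_loss]; a general [f] also covers the
    Lipschitz envelope [Cf]. *)
Let mean (f : W -> R) (w : T) : R := n%:R^-1 * \sum_(i < n) f (Z i w).
Let expect (f : W -> R) : R :=
  n%:R^-1 * \sum_(i < n) fine ('E_P[fun w => f (Z i w)])%E.

Let deviation f (x : R) : set T := [set w | x < `|mean f w - expect f|].

Lemma measurable_empirical_mean f : measurable_fun setT f -> measurable_fun setT (mean f).
Proof.
move=> mf; apply: measurable_funM => //; apply: measurable_sum => i.
exact: measurableT_comp.
Qed.

(** This is [bern] with all weights equal to [1 / n], whose Euclidean norm is [1 / sqrt n] and whose
    sup norm is [1 / n]. *)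
Lemma empirical_mean_tail f (K t : R) :
  measurable_fun setT f -> 0 < K -> 0 <= t ->
  (forall i, P.-integrable setT (fun w => (f (Z i w))%:E)) ->
  (forall i, psi1_le P (fun w => f (Z i w) - fine ('E_P[fun w => f (Z i w)])%E) K) ->
  let B := deviation f (K * (Num.sqrt (t / n%:R) + t / n%:R)) in
  measurable B /\ (P B <= (2 * expR (- (c * t)))%:E)%E.
Proof.
move=> mf K0 t0 fint fpsi B.
have nR : 0 < n%:R :> R by rewrite ltr0n.
have mdev : measurable_fun setT (fun w => `|mean f w - expect f|).
  apply: measurableT_comp => //; apply: measurable_funB => //.
  exact: measurable_empirical_mean.
have mdevB x : measurable (deviation f x).
  by rewrite -[X in measurable X]setTI; exact: (measurable_fun_ltr _ mdev).
split; first exact: mdevB.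
pose X i w := f (Z i w) - fine ('E_P[fun w => f (Z i w)])%E.
have mX i : measurable_fun setT (X i).
  by apply: measurable_funB => //; exact: measurableT_comp.
have iX : indep_family P X.
  apply: (@indep_family_comp _ _ _ _ _ Z (fun i z => f z - fine ('E_P[fun w => f (Z i w)])%E)) => //.
  by move=> i; exact: measurable_funB.
have X0 i := expectation_centered (fint i).
have := bern K0 mX iX (fun i => (X0 i).1) (fun i => (X0 i).2) fpsi (fun=> n%:R^-1) t0.
rewrite vnorm2_const ?invr_ge0 // vnorminf_const ?invr_ge0 //.
suff -> : B = [set w | K * (Num.sqrt n%:R / n%:R * Num.sqrt t + n%:R^-1 * t) <
               `|\sum_(i < n) n%:R^-1 * X i w|] by [].
have nE : Num.sqrt n%:R / n%:R = (Num.sqrt n%:R)^-1 :> R.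
  by rewrite -{2}(sqr_sqrtr (ltW nR)) expr2 invfM mulrA divff ?mul1r // gt_eqF // sqrtr_gt0.
have tE : Num.sqrt n%:R / n%:R * Num.sqrt t + n%:R^-1 * t = Num.sqrt (t / n%:R) + t / n%:R.
  by rewrite nE sqrtrM // sqrtrV ?ltW // [n%:R^-1 * t]mulrC [_^-1 * _]mulrC.
rewrite tE; apply/seteqP.
by split => w; rewrite /B /deviation /mean /expect /= -mulrBr -sumrB -mulr_sumr.
Qed.

End empirical_process.

(** * Integrability and Lipschitz bounds for expectations *)

Section expectation_bounds.
Context (R : realType) (d : measure_display) (T : measurableType d) (P : probability T R).

Lemma integrable_of_abs_expectation (X : T -> R) (m : R) : measurable_fun setT X ->
  ('E_P[fun w => `|X w|%R] <= m%:E)%E -> P.-integrable setT (fun w => (X w)%:E).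
Proof.
move=> mX Xm; apply/integrableP; split; first exact/measurable_EFinP.
by move: Xm; rewrite expectation_integral => /le_lt_trans; apply; exact: ltry.
Qed.

Lemma expectation_le_abs (X : T -> R) (m : R) : measurable_fun setT X ->
  (forall w, 0 <= X w) -> ('E_P[fun w => `|X w|%R] <= m%:E)%E ->
  fine ('E_P[X])%E <= m.
Proof.
move=> mX X0 Xm; have Xint := integrable_of_abs_expectation mX Xm.
rewrite -lee_fin fineK; last by rewrite expectation_integral; exact: integrable_fin_num.
apply: le_trans Xm; rewrite !expectation_integral.
by under [leRHS]eq_integral do rewrite ger0_norm //.
Qed.

(** The distance is at most the integral of [|X - Y|], which is compared with that of [C * k] almost
    everywhere. *)
Lemma expectation_dist_le (X Y C : T -> R) (k m : R) :
  P.-integrable setT (fun w => (X w)%:E) -> P.-integrable setT (fun w => (Y w)%:E) ->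
  measurable_fun setT C -> 0 <= k -> (forall w, 0 <= C w) ->
  ('E_P[fun w => `|C w|%R] <= m%:E)%E ->
  {ae P, forall w, `|X w - Y w| <= C w * k} ->
  `|fine ('E_P[X])%E - fine ('E_P[Y])%E| <= m * k.
Proof.
move=> iX iY mC k0 C0 Cm XYC.
have fX : (\int[P]_w (X w)%:E)%E \is a fin_num by exact: integrable_fin_num.
have fY : (\int[P]_w (Y w)%:E)%E \is a fin_num by exact: integrable_fin_num.
have mX : measurable_fun setT X by apply/measurable_EFinP; exact: measurable_int iX.
have mY : measurable_fun setT Y by apply/measurable_EFinP; exact: measurable_int iY.
have mXY : measurable_fun setT (fun w => X w - Y w) by exact: measurable_funB.
have iC := integrable_of_abs_expectation mC Cm.
have k1 : (\int[P]_w (C w * k)%:E <= (m * k)%:E)%E.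
  under eq_integral do rewrite EFinM.
  rewrite integralZr // EFinM lee_wpmul2r ?lee_fin //.
  apply: le_trans Cm; rewrite expectation_integral.
  by under [leRHS]eq_integral do rewrite ger0_norm //.
rewrite !expectation_integral -fineB // -integralB_EFin // -lee_fin.
have iXY : (\int[P]_w ((X w)%:E - (Y w)%:E))%E \is a fin_num.
  by rewrite integralB_EFin // fin_numB fX.
rewrite -fine_abse // fineK ?abse_fin_num //.
apply: le_trans k1; apply: le_trans (le_abse_integral _ _ _) _ => //.
  exact/measurable_EFinP.
apply: ae_ge0_le_integral => //.
- by apply: measurableT_comp => //; exact/measurable_EFinP.
- by move=> w _; rewrite lee_fin mulr_ge0.
- by apply/measurable_EFinP; exact: measurable_funM.
- by apply: filterS XYC => w XYw _; rewrite lee_fin.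
Qed.
End expectation_bounds.

(** * Elementary real inequalities *)

Section real_bounds.
Context (R : realType).

(** The gap between the two sides is the square [(M sqrt x - 1) ^ 2 / (2 M)]. *)
Lemma sqrt_le_amgm (M x : R) : 0 < M -> 0 <= x -> Num.sqrt x <= (M * x + M^-1) / 2.
Proof.
move=> M0 x0; have Mn0 : M != 0 by rewrite gt_eqF.
have -> : (M * x + M^-1) / 2
  = (M * Num.sqrt x - 1) ^+ 2 / (2 * M) + Num.sqrt x.
  by rewrite -{1}(sqr_sqrtr x0); field.
by rewrite lerDr divr_ge0 ?sqr_ge0 // mulr_ge0 // ltW.
Qed.

(* AM-GM with weight [M] trades [sqrt (x / M ^ 3)] for [x / M ^ 2] plus [1 / M]. *)
Lemma deviation_threshold_le (M x t : R) : 1 <= M -> 0 <= x -> t = 2 * x + 2 * M ->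
  Num.sqrt (t / M ^+ 3) + t / M ^+ 3 <= 3 * x / M ^+ 2 + 7 / 2 / M.
Proof.
move=> M1 x0 tE; have M0 : 0 < M by lra.
have Mn0 : M != 0 by rewrite gt_eqF.
have t0 : 0 <= t by rewrite tE; lra.
(* As [M >= 1], the linear term is at most [t / M ^ 2]; the square root adds
   [x / M ^ 2 + 3 / (2 M)]. *)
have tM : t / M ^+ 3 <= 2 * x / M ^+ 2 + 2 / M.
  rewrite (_ : 2 * x / M ^+ 2 + 2 / M = (M * t) / M ^+ 3); last by rewrite tE; field.
  by rewrite ler_pM2r ?invr_gt0 ?exprn_gt0 // ler_peMl.
have := @sqrt_le_amgm M (t / M ^+ 3) M0 (divr_ge0 t0 (exprn_ge0 _ (ltW M0))).
have -> : (M * (t / M ^+ 3) + M^-1) / 2 = x / M ^+ 2 + 3 / 2 / M by rewrite tE; field.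
have -> : 3 * x / M ^+ 2 + 7 / 2 / M = (x / M ^+ 2 + 3 / 2 / M) + (2 * x / M ^+ 2 + 2 / M) by field.
by move=> h; exact: lerD.
Qed.

(** With [u = p z <= 1 / 2], the chain is [(1 + z) ^ p <= exp u <= 1 / (1 - u) <= 2]. *)
Lemma exp1Dx_le2 (z : R) p : 0 <= z -> p%:R * z <= 2^-1 -> (1 + z) ^+ p <= 2.
Proof.
move=> z0 pz.
apply: (@le_trans _ _ (expR (p%:R * z))).
  rewrite expRM_natl; apply: lerXn2r; rewrite ?nnegrE ?expR_ge0 ?expR_ge1Dx //; lra.
have := expR_ge1Dx (- (p%:R * z)); rewrite expRN => h.
by rewrite -[expR _]invrK -[leRHS]invrK lef_pV2 ?posrE ?invr_gt0 ?expR_gt0 //; lra.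
Qed.

Lemma powR_third_expn (x : R) : 0 <= x -> (x `^ 3^-1) ^+ 3 = x.
Proof. by move=> x0; rewrite -powR_mulrn ?powR_ge0 // -powRrM mulVf ?powRr1. Qed.

Lemma powR_two_thirds (x : R) : x `^ (2 / 3) = (x `^ 3^-1) ^+ 2.
Proof. by rewrite -powR_mulrn ?powR_ge0 // -powRrM mulrC. Qed.

Lemma powR_third_ge1 (n : nat) : (0 < n)%N -> 1 <= n%:R `^ 3^-1 :> R.
Proof.
move=> n0; apply: (@le_trans _ _ ((1 : R) `^ 3^-1)); first by rewrite powR1.
by apply: ge0_ler_powR; rewrite ?nnegrE ?invr_ge0 // ler1n.
Qed.

End real_bounds.

(** * Uniform deviation of the empirical loss over a sup-norm ball *)

Section uniform_deviation.
Context (R : realType) (d : measure_display) (T : measurableType d) (P : probability T R).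
Context (dW : measure_display) (W : measurableType dW).
Context (n p : nat) (Z : 'I_n -> T -> W) (L : 'rV[R]_p -> W -> R) (Cf : W -> R).
Context (c sigma sigmaL Cmu R0 : R) (beta0 : 'rV[R]_p).
Hypotheses (n0 : (0 < n)%N) (p0 : (0 < p)%N) (c0 : 0 < c) (R1 : 1 <= R0).
Hypotheses (mZ : forall i, measurable_fun setT (Z i)) (iZ : indep_family P Z).
Hypotheses (mL : forall b, measurable_fun setT (L b))
  (intL : forall b i, P.-integrable setT (fun w => (L b (Z i w))%:E)).
Hypotheses (sigma1 : 1 <= sigma)
  (psiL : forall b i,
     psi1_le P (fun w => L b (Z i w) - fine ('E_P[fun w => L b (Z i w)])%E) sigma).
Hypothesis bern : bernstein_const P c.
Hypotheses (mCf : measurable_fun setT Cf) (Cf0 : forall z, 0 <= Cf z)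
  (sigmaL1 : 1 <= sigmaL) (Cmu1 : 1 <= Cmu)
  (psiC : forall i,
     psi1_le P (fun w => Cf (Z i w) - fine ('E_P[fun w => Cf (Z i w)])%E) sigmaL)
  (CfE : forall i, ('E_P[fun w => `|Cf (Z i w)|%R] <= Cmu%:E)%E)
  (lipL : forall i, {ae P, forall w (b1 b2 : 'rV[R]_p),
     `|L b1 (Z i w) - L b2 (Z i w)| <= Cf (Z i w) * l2norm (b1 - b2)}).

Let M : R := n%:R `^ 3^-1.
Let zeta : R := ln (M * p%:R) + ln (3 * expR 1 * R0 * (sigmaL + Cmu)).

Let M1 : 1 <= M.
Proof. exact: powR_third_ge1. Qed.

Let p1 : 1 <= p%:R :> R. Proof. by rewrite ler1n. Qed.

Lemma expR_log_factor : expR zeta = M * p%:R * (3 * expR 1 * R0 * (sigmaL + Cmu)).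
Proof.
have e0 := @expR_gt0 R 1; have := M1; have := p1.
move: R1 sigmaL1 Cmu1 => R1' sigmaL1' Cmu1' p1' M1'.
by rewrite expRD !lnK // posrE !mulr_gt0 //; lra.
Qed.

(** Apart from [expR 1], all factors of [expR zeta] are at least one. *)
Lemma log_factor_ge1 : 1 <= zeta.
Proof.
rewrite -ler_expR expR_log_factor; have e0 := @expR_gt0 R 1.
move: R1 sigmaL1 Cmu1 => R1' sigmaL1' Cmu1'.
have Mp : 1 <= M * p%:R by rewrite mulr_ege1.
have RS : 1 <= R0 * (sigmaL + Cmu) by rewrite mulr_ege1 //; lra.
rewrite (_ : _ * _ = expR 1 * (M * p%:R * (R0 * (sigmaL + Cmu)) * 3)); last by ring.
apply: ler_peMr; first exact: ltW.
by rewrite mulr_ege1 ?mulr_ege1 //; lra.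
Qed.

Lemma emp_loss_dist_le w b1 b2 :
  (forall i, `|L b1 (Z i w) - L b2 (Z i w)| <= Cf (Z i w) * l2norm (b1 - b2)) ->
  `|emp_loss Z L b1 w - emp_loss Z L b2 w|
    <= n%:R^-1 * (\sum_(i < n) Cf (Z i w)) * l2norm (b1 - b2).
Proof.
move=> lip; rewrite /emp_loss -mulrBr -sumrB normrM ger0_norm ?invr_ge0 // -mulrA.
rewrite ler_wpM2l ?invr_ge0 // mulr_suml; apply: le_trans (ler_norm_sum _ _ _) _.
by apply: ler_sum => i _; exact: lip.
Qed.

Lemma pop_loss_dist_le b1 b2 :
  `|pop_loss P Z L b1 - pop_loss P Z L b2| <= Cmu * l2norm (b1 - b2).
Proof.
have nR : n%:R != 0 :> R by rewrite pnatr_eq0 -lt0n.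
rewrite /pop_loss -mulrBr -sumrB normrM ger0_norm ?invr_ge0 //.
have -> : Cmu * l2norm (b1 - b2) = n%:R^-1 * \sum_(i < n) (Cmu * l2norm (b1 - b2)).
  by rewrite sumr_const card_ord -[_ * _ *+ n]mulr_natl mulKf.
rewrite ler_wpM2l ?invr_ge0 //; apply: le_trans (ler_norm_sum _ _ _) _.
apply: ler_sum => i _; apply: (@expectation_dist_le _ _ _ _ _ _ (fun w => Cf (Z i w))) => //.
- exact: measurableT_comp.
- exact: sqrtr_ge0.
- by apply: filterS (lipL i) => w; exact.
Qed.

(** The set [U] collects large deviations on the grid, a large deviation at [beta0], a large mean of
    the envelope [Cf], and a null set where the Lipschitz bound fails. Since one set serves all [b],
    the bound can be evaluated at a data-dependent vector. The comparator [beta0] is fixed and has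
    its own event, hence no support term in its bound. *)
Lemma uniform_deviation : exists U : set T,
  [/\ measurable U,
      (P U <= (2 * expR (- (c * n%:R)) + 6 * expR (- (2 * c * M)))%:E)%E
    & forall w, ~ U w ->
      (forall b, linfnorm b <= R0 -> pop_loss P Z L b <= emp_loss Z L b w
         + (l0norm b)%:R * (4 * sigma * zeta / (c * M ^+ 2)) + 11 / 2 * sigma / M)
      /\ emp_loss Z L beta0 w <= pop_loss P Z L beta0 + 7 / 2 * sigma / M].
Proof.
have nR : n%:R = M ^+ 3 by rewrite powR_third_expn.
have M0 : 0 < M by have := M1; lra.
have z1 := log_factor_ge1.
move: c0 R1 sigma1 sigmaL1 Cmu1 => c0' R1' sigma1' sigmaL1' Cmu1'.
set S := sigmaL + Cmu; have S0 : 0 < S by rewrite /S; lra.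
(* This mesh makes the rounding error [p * delta] equal to [1 / (M * S)]. *)
pose delta := (p%:R * M * S)^-1.
have d0 : 0 < delta by rewrite invr_gt0 !mulr_gt0 // ltr0n.
pose N := Num.truncn (R0 / delta).
have R0d : 0 <= R0 / delta by rewrite divr_ge0 // ?ltW //; lra.
have /andP[Nle Nlt] := truncn_itv R0d.
pose G : finType := {ffun 'I_p -> 'I_(N.*2.+1)}.
pose pt (g : G) := grid_point delta g.
(* With [k] nonzero entries, [c * tg] is [2 k zeta + 2 c M]: each entry gains a factor
   [expR zeta ^- 2], which pays for its position and its grid value. *)
pose tg (b : 'rV[R]_p) := 2 * ((l0norm b)%:R * zeta / c) + 2 * M.
have tg0 b : 0 <= tg b by rewrite addr_ge0 ?mulr_ge0 ?invr_ge0 //; lra.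
have sigma0 : 0 < sigma by lra.
have sigmaL0 : 0 < sigmaL by lra.
have zeta0 : 0 <= zeta by lra.
have q0 : 0 <= sigma * zeta / (c * M ^+ 2).
  by apply: divr_ge0; apply: mulr_ge0; rewrite ?exprn_ge0 // ltW.
have bernL b t (t0 : 0 <= t) :=
  @empirical_mean_tail _ _ _ P _ _ _ _ mZ iZ n0 _ bern _ _ _ (mL b) sigma0 t0 (intL b) (psiL b).
have [UN [mUN PUN UNP]] := finite_union_bound (fun g => (bernL (pt g) _ (tg0 (pt g))).1)
  (fun g => (bernL (pt g) _ (tg0 (pt g))).2).
have M20 : 0 <= 2 * M by lra.
set U0 := [set w | sigma * (Num.sqrt (2 * M / n%:R) + 2 * M / n%:R)
  < `|emp_loss Z L beta0 w - pop_loss P Z L beta0|].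
have [mU0 PU0] : measurable U0 /\ (P U0 <= (2 * expR (- (c * (2 * M))))%:E)%E.
  exact: (bernL beta0 _ M20).
have iC i : P.-integrable setT (fun w => (Cf (Z i w))%:E).
  by apply: integrable_of_abs_expectation (CfE i); exact: measurableT_comp.
(* At level [t = n] the deviation threshold is [2 sigmaL], and the failure probability is
   [2 exp (- c n)]. *)
have [] := empirical_mean_tail mZ iZ n0 bern mCf sigmaL0 (ler0n R n) iC psiC.
set UC := (X in measurable X) => mUC PUC.
have [A [mA PA0 AP]] : {ae P, forall w, forall i (b1 b2 : 'rV[R]_p),
     `|L b1 (Z i w) - L b2 (Z i w)| <= Cf (Z i w) * l2norm (b1 - b2)}.
  exact: filter_forall.
exists (UN `|` U0 `|` UC `|` A); split.
- by do 3 ?apply: measurableU.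
- have netsum : \sum_(g : G) 2 * expR (- (c * tg (pt g))) <= 4 * expR (- (2 * c * M)).
    pose y := expR (- (2 * zeta)).
    have y0 : 0 < y by exact: expR_gt0.
    rewrite (eq_bigr (fun g : G => 2 * expR (- (2 * c * M)) * y ^+ l0norm (pt g))); last first.
      move=> g _; rewrite -expRM_natl -mulrA -expRD; congr (2 * expR _).
      by rewrite /tg; field; rewrite gt_eqF.
    rewrite -mulr_sumr sum_exp_l0norm_grid_point ?gt_eqF //.
    rewrite (_ : 4 * _ = 2 * expR (- (2 * c * M)) * 2); last by ring.
    rewrite ler_pM2l ?mulr_gt0 ?expR_gt0 //; apply: exp1Dx_le2; first by rewrite mulr_ge0 // ltW.
    have yE : y = (M * p%:R * (3 * expR 1 * R0 * S)) ^- 2.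
      by rewrite /y expRN expRM_natl expR_log_factor.
    have e1 : 1 <= expR 1 :> R by have := @expR_ge1Dx R 1; lra.
    apply: (@le_trans _ _ (p%:R * (2 * (R0 / delta) * y))).
      by rewrite ler_pM2l ?ltr0n // ler_pM2r // -mul2n natrM ler_pM2l.
    rewrite yE mulrA ler_pdivrMr; last by rewrite exprn_gt0 // !mulr_gt0 ?ltr0n //; lra.
    (* The claim becomes [2 B <= (9 / 2) B F] with [F = e ^ 2 M R0 S >= 1]. *)
    pose B := p%:R ^+ 2 * R0 * M * S.
    have B0 : 0 < B by rewrite !mulr_gt0 ?exprn_gt0 ?ltr0n //; lra.
    have F1 : 1 <= expR 1 ^+ 2 * (M * R0 * S).
      rewrite mulr_ege1 ?exprn_ege1 // mulr_ege1 //; last by rewrite /S; lra.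
      by rewrite mulr_ege1.
    rewrite (_ : p%:R * (2 * (R0 / delta)) = 2 * B); last by rewrite /delta /B invrK; ring.
    rewrite (_ : _ ^+ 2 = 9 * (B * (expR 1 ^+ 2 * (M * R0 * S)))); last by rewrite /B; ring.
    by have := ler_peMr (ltW B0) F1; lra.
  have PN := le_trans PUN (netsum : (_%:E <= _%:E)%E).
  apply: le_trans (measureU2 _ _ mA) _; first by do 2 ?apply: measurableU.
  rewrite [X in (_ + X)%E](_ : _ = 0%E) ?adde0; last exact: PA0.
  apply: le_trans (measureU2 _ _ mUC) _; first exact: measurableU.
  apply: le_trans (leeD (measureU2 _ mUN mU0) PUC) _.
  apply: le_trans (leeD (leeD PN PU0) (lexx _)) _.
  by rewrite -!EFinD lee_fin [c * (2 * M)]mulrCA mulrA; lra.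
- move=> w Uw.
  have nUN g := contra_not (UNP g w) (fun h => Uw (or_introl (or_introl (or_introl h)))).
  have nU0 : ~ U0 w by move=> h; apply: Uw; left; left; right.
  have nUC : ~ UC w by move=> h; apply: Uw; left; right.
  have lipw i b1 b2 : `|L b1 (Z i w) - L b2 (Z i w)| <= Cf (Z i w) * l2norm (b1 - b2).
    by apply: contrapT => h; apply: Uw; right; apply: AP => /= H; apply: h; exact: H.
  have Cmean : n%:R^-1 * (\sum_(i < n) Cf (Z i w)) <= Cmu + 2 * sigmaL.
    have : `|n%:R^-1 * (\sum_(i < n) Cf (Z i w))
        - n%:R^-1 * (\sum_(i < n) fine ('E_P[fun w => Cf (Z i w)])%E)|
      <= sigmaL * (Num.sqrt (n%:R / n%:R) + n%:R / n%:R).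
      by rewrite leNgt; apply/negP.
    rewrite divff ?pnatr_eq0 -?lt0n // sqrtr1 => /(le_trans (ler_norm _)).
    suff : n%:R^-1 * (\sum_(i < n) fine ('E_P[fun w => Cf (Z i w)])%E) <= Cmu by lra.
    rewrite mulrC ler_pdivrMr ?ltr0n // mulr_natr.
    apply: (@le_trans _ _ (\sum_(i < n) Cmu)); last by rewrite sumr_const card_ord.
    by apply: ler_sum => i _; apply: expectation_le_abs => //; exact: measurableT_comp.
  split=> [b bR|].
    have bN : linfnorm b < N.+1%:R * delta by rewrite (le_lt_trans bR) // -ltr_pdivrMr.
    have [g [gb bg]] := grid_point_near d0 bN.
    have devg : `|emp_loss Z L (pt g) w - pop_loss P Z L (pt g)|
      <= sigma * (Num.sqrt (tg (pt g) / n%:R) + tg (pt g) / n%:R).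
      by rewrite leNgt; apply/negP; exact: nUN.
    have x0 : 0 <= (l0norm (pt g))%:R * zeta / c.
      by apply: divr_ge0 (ltW c0); exact: mulr_ge0.
    have thr := deviation_threshold_le M1 x0 (erefl (tg (pt g))).
    rewrite nR in devg.
    have {}devg := le_trans devg (ler_wpM2l (ltW sigma0) thr).
    have lipe := emp_loss_dist_le (fun i => lipw i b (pt g)).
    have lipp := pop_loss_dist_le b (pt g).
    have l2pos : 0 <= l2norm (b - pt g) by exact: sqrtr_ge0.
    have lipe' := le_trans lipe (ler_wpM2r l2pos Cmean).
    (* The Lipschitz constants [Cmu + 2 sigmaL] (empirical) and [Cmu] (population) add up to
       [2 S]. *)
    have Sbg : 2 * S * l2norm (b - pt g) <= 2 * S * (p%:R * delta) by rewrite ler_pM2l ?mulr_gt0.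
    have SE : 2 * S * (p%:R * delta) = 2 / M.
      by rewrite /delta; field; rewrite !gt_eqF ?ltr0n.
    have kle : (l0norm (pt g))%:R * (sigma * zeta / (c * M ^+ 2))
        <= (l0norm b)%:R * (sigma * zeta / (c * M ^+ 2)).
      by rewrite ler_wpM2r ?ler_nat.
    have kE : sigma * (3 * ((l0norm (pt g))%:R * zeta / c) / M ^+ 2 + 7 / 2 / M)
        = 3 * ((l0norm (pt g))%:R * (sigma * zeta / (c * M ^+ 2))) + 7 / 2 * sigma / M.
      by field; rewrite !gt_eqF.
    (* The coefficient [3] of the grid deviation is enlarged to [4], the value matched by the
       penalty. *)
    have bE : (l0norm b)%:R * (4 * sigma * zeta / (c * M ^+ 2))
        = 4 * ((l0norm b)%:R * (sigma * zeta / (c * M ^+ 2))) by ring.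
    have k0 : 0 <= (l0norm b)%:R * (sigma * zeta / (c * M ^+ 2)).
      exact: mulr_ge0.
    (* The rounding cost [2 / M] joins [7 / 2 * sigma / M] to give [11 / 2 * sigma / M]. *)
    have sM : 2 / M <= 2 * sigma / M by rewrite ler_pM2r ?invr_gt0 // ler_peMr.
    have lipp' := le_trans (ler_norm _) lipp.
    have devg' := le_trans (ler_norm _) (eq_ind_r (fun x => x <= _) devg (distrC _ _)).
    have lipe'' := le_trans (ler_norm _) (eq_ind_r (fun x => x <= _) lipe' (distrC _ _)).
    rewrite kE in devg'; rewrite bE; move: Sbg; rewrite SE /S => Sbg; lra.
  have : `|emp_loss Z L beta0 w - pop_loss P Z L beta0|
      <= sigma * (Num.sqrt (2 * M / n%:R) + 2 * M / n%:R) by rewrite leNgt; apply/negP.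
  rewrite nR => /(le_trans (ler_norm _)) h.
  have tE : 2 * M = 2 * 0 + 2 * M by rewrite mulr0 add0r.
  have := ler_wpM2l (ltW sigma0) (deviation_threshold_le M1 (lexx 0) tE).
  by rewrite mulr0 mul0r add0r; lra.
Qed.
End uniform_deviation.

(** * From the basic inequality to the stated rates *)

Section final_bounds.
Context (R : realType).

(** The [4 / c] part of the constant takes the penalty of the comparator and the [9] takes the
    remainder; [q1] and [q2] stand for the two square roots of the rate. *)
Lemma nonconvex_rate_le (c sigma s zeta M G q1 q2 : R) :
  0 < c -> 1 <= sigma -> 0 <= s -> 0 <= zeta -> 0 < M -> 0 <= q1 -> 0 <= q2 ->
  s * (4 * sigma * zeta / (c * M ^+ 2)) + G + 9 * sigma / M
  <= (9 + 4 / c) * sigma * (s * zeta / M ^+ 2 + q1 + M^-1) + (9 + 4 / c) * q2 + G.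
Proof.
move=> c0 sigma1 s0 zeta0 M0 q10 q20.
have C0 : 0 < 4 / c by rewrite divr_gt0.
have h1 : 0 <= (9 + 4 / c) * q2 by apply: mulr_ge0 => //; lra.
have h2 : 0 <= (9 + 4 / c) * sigma * q1 by apply: mulr_ge0 => //; apply: mulr_ge0; lra.
have h3 : 0 <= 9 * sigma * (s * zeta / M ^+ 2).
  apply: mulr_ge0; first lra.
  by apply: divr_ge0; [exact: mulr_ge0 | rewrite exprn_ge0 // ltW].
have h4 : 0 <= 4 / c * sigma * M^-1.
  by apply: mulr_ge0; [apply: mulr_ge0; lra | rewrite invr_ge0 ltW].
have -> : s * (4 * sigma * zeta / (c * M ^+ 2)) = 4 / c * sigma * (s * zeta / M ^+ 2).
  by field; rewrite !gt_eqF.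
lra.
Qed.

Lemma lasso_rate_le (c sigma s zeta M a R0 lam q eps : R) :
  0 < c <= 2^-1 -> 1 <= sigma -> 1 <= s -> 1 <= zeta -> 1 <= M -> 0 < a <= 1 -> 1 <= R0 ->
  lam = Num.sqrt (8 * sigma / (c * a * M ^+ 2) * zeta) -> 0 <= q ->
  lam * (s * R0) + eps + 9 * sigma / M
  <= (9 + 8 / c) * a `^ (- 2^-1) * s * sigma * (zeta / M ^+ 2 + R0 * Num.sqrt zeta / M)
     + (9 + 8 / c) * q + eps.
Proof.
move=> /andP[c0 c2] sigma1 s1 zeta1 M1 /andP[a0 a1] R1 -> q0.
have M0 : 0 < M by lra.
have zE : Num.sqrt zeta ^+ 2 = zeta by rewrite sqr_sqrtr //; lra.
have z1 : 1 <= Num.sqrt zeta by rewrite -sqrtr1 ler_wsqrtr.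
move: (Num.sqrt zeta) zE z1 => z zE z1.
have [al [al1 alE ->]] : exists al, [/\ 1 <= al, al ^+ 2 = a^-1 & a `^ (- 2^-1) = al].
  exists (Num.sqrt a)^-1; split; last by rewrite powRN powR12_sqrt // ltW.
    by rewrite invf_ge1 ?sqrtr_gt0 // -sqrtr1 ler_wsqrtr.
  by rewrite exprVn sqr_sqrtr // ltW.
have c8 : 1 <= 8 / c by rewrite ler_pdivlMr //; lra.
(* Since [8 sigma / c >= 1], its square root is at most itself; [al] is [a] to the power
   [- 1 / 2]. *)
have lamle : Num.sqrt (8 * sigma / (c * a * M ^+ 2) * zeta) <= 8 / c * al * sigma * z / M.
  rewrite -[leRHS]ger0_norm; last first.
    by rewrite !mulr_ge0 // ?invr_ge0; lra.
  rewrite -sqrtr_sqr ler_wsqrtr // !(exprMn, exprVn) alE zE.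
  rewrite (_ : 8 * sigma / (c * a * M ^+ 2) * zeta = (8 / c * sigma) * (a^-1 * zeta / M ^+ 2));
    last by field; rewrite !gt_eqF.
  rewrite (_ : 8 ^+ 2 / c ^+ 2 / a * sigma ^+ 2 * zeta / M ^+ 2
      = (8 / c * sigma) * (8 / c * sigma) * (a^-1 * zeta / M ^+ 2));
    last by field; rewrite !gt_eqF.
  have c8s : 1 <= 8 / c * sigma by rewrite mulr_ege1.
  rewrite ler_wpM2r ?ler_peMr //; last by lra.
  by rewrite !mulr_ge0 ?invr_ge0 ?exprn_ge0 //; lra.
(* The main term of the rate is a multiple of [sigma / M * Q]; from [Q >= 1] it also absorbs
   [9 * sigma / M]. *)
pose Q := al * s * R0 * z.
have Q1 : 1 <= Q by rewrite !mulr_ege1.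
have h1 : Num.sqrt (8 * sigma / (c * a * M ^+ 2) * zeta) * (s * R0)
    <= 8 / c * (sigma / M * Q).
  rewrite (_ : _ * (sigma / M * Q) = 8 / c * al * sigma * z / M * (s * R0)); last by rewrite /Q; ring.
  by rewrite ler_wpM2r // mulr_ge0; lra.
have sM0 : 0 <= sigma / M by apply: divr_ge0; lra.
have h2 : sigma / M <= sigma / M * Q by rewrite ler_peMr.
have h3 : 0 <= (9 + 8 / c) * q by apply: mulr_ge0 => //; lra.
have h4 : 0 <= (9 + 8 / c) * al * s * sigma * (zeta / M ^+ 2).
  by rewrite !mulr_ge0 // ?invr_ge0 ?exprn_ge0 //; lra.
rewrite (_ : (9 + 8 / c) * al * s * sigma * (zeta / M ^+ 2 + R0 * z / M)
  = (9 + 8 / c) * al * s * sigma * (zeta / M ^+ 2) + 9 * (sigma / M * Q)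
    + 8 / c * (sigma / M * Q)); last by rewrite /Q; ring.
lra.
Qed.
End final_bounds.

(** * Assembly of both oracle inequalities *)

Lemma sub_prob_setC (R : realType) d (T : measurableType d) (P : probability T R)
    (U : set T) (x : R) :
  measurable U -> (P U <= x%:E)%E -> ((1 - x)%:E <= P (~` U))%E.
Proof.
move=> mU PU; rewrite probability_setC // EFinB; exact: leeB.
Qed.

(** The case [n = 0] is covered through [ln 0 = 0], so the bound is available before the sample-size
    condition has yielded [0 < n]. *)
Lemma log_factor_ge0 (R : realType) (n p : nat) (R0 S : R) : (0 < p)%N -> 1 <= R0 -> 1 <= S ->
  0 <= ln (n%:R `^ 3^-1 * p%:R) + ln (3 * expR 1 * R0 * S).
Proof.
move=> p0 R1 S1; have e1 := @expR_ge1Dx R 1.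
apply: addr_ge0; last first.
  by apply: ln_ge0; rewrite !mulr_ege1 //; lra.
case: n => [|n]; first by rewrite powR0 ?invr_eq0 ?pnatr_eq0 // mul0r ln0.
by apply: ln_ge0; rewrite mulr_ege1 ?ler1n // powR_third_ge1.
Qed.

Unset Implicit Arguments.

Theorem theorem1 (R : realType) (c : R) :
  0 < c <= 2^-1 ->
  exists ct C3 C4 : R, 0 < ct /\ 0 < C3 /\ 0 < C4 /\
  forall (d : measure_display) (T : measurableType d) (P : probability T R)
    (dW : measure_display) (W : measurableType dW)
    (n p : nat) (Z : 'I_n -> T -> W) (L : 'rV[R]_p -> W -> R) (Cf : W -> R)
    (sigma sigmaL Cmu UL R0 a lam eps : R)
    (beta_star beta_eps : 'rV[R]_p) (betahat betal1 : T -> 'rV[R]_p),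
  (2 < p)%N ->
  (* the sample: i.i.d. random elements of W *)
  (forall i, measurable_fun setT (Z i)) ->
  indep_family P Z -> ident_distr P Z ->
  (* the loss *)
  (forall b, measurable_fun setT (L b)) ->
  (forall b i, P.-integrable setT (fun w => (L b (Z i w))%:E)) ->
  (forall i, {ae P, forall w, C1fun (fun b => L b (Z i w))}) ->
  1 <= UL ->
  {ae P, forall w (bt : 'rV[R]_p) (delta : R) (j : 'I_p),
     `|'D_(evec j) (fun b => emp_loss Z L b w) (bt + delta *: evec j)
       - 'D_(evec j) (fun b => emp_loss Z L b w) bt| <= UL * `|delta| } ->
  (* the population minimiser *)
  (forall b, pop_loss P Z L beta_star <= pop_loss P Z L b) ->
  linfnorm beta_star <= R0 -> 1 <= R0 ->
  (* (A1) *)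
  0 <= eps -> linfnorm beta_eps <= R0 -> (1 <= l0norm beta_eps)%N ->
  pop_loss P Z L beta_eps - pop_loss P Z L beta_star <= eps ->
  (* (A2) *)
  1 <= sigma ->
  (forall b i, psi1_le P (fun w => L b (Z i w) - fine ('E_P[fun w => L b (Z i w)])%E) sigma) ->
  bernstein_const P c ->
  (* (A3) *)
  measurable_fun setT Cf -> (forall z, 0 <= Cf z) ->
  1 <= sigmaL -> 1 <= Cmu ->
  (forall i, psi1_le P (fun w => Cf (Z i w) - fine ('E_P[fun w => Cf (Z i w)])%E) sigmaL) ->
  (forall i, ('E_P[fun w => `|Cf (Z i w)|%R] <= Cmu%:E)%E) ->
  (forall i, {ae P, forall w (b1 b2 : 'rV[R]_p),
     `|L b1 (Z i w) - L b2 (Z i w)| <= Cf (Z i w) * l2norm (b1 - b2)}) ->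
  (* tuning parameters *)
  0 < a -> a < UL^-1 ->
  let logt := ln (n%:R `^ (3^-1) * p%:R) + ln (3 * expR 1 * R0 * (sigmaL + Cmu)) in
  lam = Num.sqrt (8 * sigma / (c * a * n%:R `^ (2 / 3)) * logt) ->
  (* the S^3ONC solution *)
  (forall w, linfnorm (betahat w) <= R0) ->
  {ae P, forall w, S3ONC a lam UL (fun b => emp_loss Z L b w) (betahat w)} ->
  let s := (l0norm beta_eps)%:R in
  let prob := 1 - 2 * (p%:R + 1) * expR (- (ct * n%:R))
                - 6 * expR (- (2 * c * n%:R `^ (3^-1))) in
  (* part (i) *)
  (forall Gamma : R, 0 <= Gamma ->
     C3 * (((Gamma + eps) / sigma) ^+ 3 + s * logt) < n%:R ->
     {ae P, forall w, pen_loss Z L a lam (betahat w) w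
                      <= pen_loss Z L a lam beta_eps w + Gamma} ->
     exists E : set T, measurable E /\ (prob%:E <= P E)%E /\
       forall w, E w ->
         pop_loss P Z L (betahat w) - pop_loss P Z L beta_star
         <= C3 * sigma * (s * logt / n%:R `^ (2 / 3) + Num.sqrt (s * logt / n%:R)
                          + (n%:R `^ (3^-1))^-1)
            + C3 * Num.sqrt (sigma * (Gamma + eps) / n%:R `^ (3^-1))
            + Gamma + eps)
  /\
  (* part (ii) *)
  (C4 * (eps / sigma) ^+ 3
     + C4 * a^-1 * logt * s `^ (3 / 2) * R0 `^ (3 / 2) < n%:R ->
   {ae P, forall w, forall b : 'rV[R]_p,
      emp_loss Z L (betal1 w) w + lam * l1norm (betal1 w)
      <= emp_loss Z L b w + lam * l1norm b} ->
   {ae P, forall w, pen_loss Z L a lam (betahat w) w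
                    <= pen_loss Z L a lam (betal1 w) w} ->
   exists E : set T, measurable E /\ (prob%:E <= P E)%E /\
     forall w, E w ->
       pop_loss P Z L (betahat w) - pop_loss P Z L beta_star
       <= C4 * a `^ (- (2^-1)) * s * sigma
            * (logt / n%:R `^ (2 / 3) + R0 * Num.sqrt logt / n%:R `^ (3^-1))
          + C4 * Num.sqrt (sigma * eps / n%:R `^ (3^-1))
          + eps).
Proof.
(* The last two constants are those of [nonconvex_rate_le] and [lasso_rate_le]. *)
move=> /andP[c0 c2]; exists c, (9 + 4 / c), (9 + 8 / c).
have c40 : 0 < 4 / c by rewrite divr_gt0.
have c80 : 0 < 8 / c by rewrite divr_gt0.
split=> //; split; first lra; split; first lra.
move=> d T P dW W n p Z L Cf sigma sigmaL Cmu UL R0 a lam eps beta_star beta_eps betahat betal1.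
move=> p2 mZ iZ _ mL intL _ UL1 _ _ _ R1 eps0 eps_inf s_ge1 eps_near sigma1 psiL bern mCf Cf0.
move=> sigmaL1 Cmu1 psiC CfE lipL a0 aUL logt lamE hatR hatS s prob.
have p0 : (0 < p)%N by exact: leq_trans p2.
have UL0 : 0 < UL by lra.
have a1 : a <= 1 by rewrite (le_trans (ltW aUL)) // invf_le1.
have s1 : 1 <= s by rewrite /s ler1n.
have logt0 : 0 <= logt by apply: log_factor_ge0 => //; lra.
have lam0 : 0 <= lam by rewrite lamE sqrtr_ge0.
pose M : R := n%:R `^ 3^-1.
have M_ge1 : (0 < n)%N -> 1 <= M by exact: powR_third_ge1.
(* The penalty of one large entry equals the coefficient of [l0norm b] in [uniform_deviation]. *)
have kapE : (0 < n)%N -> a * lam ^+ 2 / 2 = 4 * sigma * logt / (c * M ^+ 2).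
  move=> n0; have M0 : 0 < M by rewrite powR_gt0 // ltr0n.
  rewrite lamE sqr_sqrtr; last first.
    by apply: mulr_ge0 => //; apply: divr_ge0; [lra|rewrite !mulr_ge0 ?powR_ge0 // ltW].
  by rewrite powR_two_thirds -/M; field; rewrite !gt_eqF.
(* Shared by both parts: [D] is [s * (a * lam ^+ 2 / 2) + Gamma] in (i) and [lam * (s * R0)] in
   (ii). The constant [9] is [11 / 2 + 7 / 2]. *)
have core (D : R) : (0 < n)%N ->
    {ae P, forall w, pen_loss Z L a lam (betahat w) w <= emp_loss Z L beta_eps w + D} ->
    exists E : set T, [/\ measurable E, (prob%:E <= P E)%E & forall w, E w ->
      pop_loss P Z L (betahat w) - pop_loss P Z L beta_star <= D + eps + 9 * sigma / M].
  move=> n0 penD.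
  have [U [mU PU UP]] := @uniform_deviation _ _ _ P _ _ n p Z L Cf c sigma sigmaL Cmu R0 beta_eps
    n0 p0 c0 R1 mZ iZ mL intL sigma1 psiL bern mCf Cf0 sigmaL1 Cmu1 psiC CfE lipL.
  have [A [mA PA AP]] := filterI hatS penD.
  exists (~` (U `|` A)); split.
  - by apply: measurableC; exact: measurableU.
  - have PUA : (P (U `|` A) <=
        (2 * expR (- (c * n%:R)) + 6 * expR (- (2 * c * n%:R `^ 3^-1)))%:E)%E.
      by rewrite measureU0.
    apply: le_trans (sub_prob_setC (measurableU _ _ mU mA) PUA).
    rewrite lee_fin /prob.
    (* The event costs [2 exp (- c n)] where [prob] subtracts [2 (p + 1) exp (- c n)]. *)
    have : 0 <= p%:R * expR (- (c * n%:R)) by rewrite mulr_ge0 ?expR_ge0.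
    lra.
  - move=> w /not_orP[nU nA].
    have [S3 pw] : S3ONC a lam UL (fun b => emp_loss Z L b w) (betahat w)
        /\ pen_loss Z L a lam (betahat w) w <= emp_loss Z L beta_eps w + D.
      by apply: contrapT => h; apply: nA; exact: AP.
    have [dev deve] := UP w nU.
    have := dev _ (hatR w).
    move: pw; rewrite /pen_loss.
    (* The penalty at [betahat w] now cancels the support term of the deviation bound exactly. *)
    rewrite (pen_sum_thresholded a0 lam0 (S3ONC_threshold a0 aUL UL0 S3)).
    rewrite kapE // -/M -/logt; move: eps_near deve; lra.
split.
- move=> Gamma Gamma0 nlarge hatG.
  (* The left side of the sample-size condition is nonnegative, which forces [0 < n]. *)
  have n0 : (0 < n)%N.
    rewrite -(ltr_nat R); apply: le_lt_trans nlarge.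
    apply: mulr_ge0; first lra.
    apply: addr_ge0; last by rewrite mulr_ge0.
    by rewrite exprn_ge0 // divr_ge0 ?addr_ge0 //; lra.
  have M1 := M_ge1 n0.
  have [E [mE PE EP]] : exists E : set T, [/\ measurable E, (prob%:E <= P E)%E
      & forall w, E w -> pop_loss P Z L (betahat w) - pop_loss P Z L beta_star
        <= s * (a * lam ^+ 2 / 2) + Gamma + eps + 9 * sigma / M].
    apply: core => //; apply: filterS hatG => w hatw.
    have := pen_sum_le_l0norm beta_eps a0 lam0.
    by rewrite /pen_loss -/s in hatw *; lra.
  exists E; split=> //; split=> // w /EP /le_trans; apply.
  rewrite kapE // powR_two_thirds -/M.
  have := @nonconvex_rate_le R c sigma s logt M (Gamma + eps) (Num.sqrt (s * logt / n%:R))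
    (Num.sqrt (sigma * (Gamma + eps) / M)) c0 sigma1 (ler0n _ _) logt0 (lt_le_trans ltr01 M1)
    (sqrtr_ge0 _) (sqrtr_ge0 _).
  lra.
- move=> nlarge l1min hatl1.
  have n0 : (0 < n)%N.
    rewrite -(ltr_nat R); apply: le_lt_trans nlarge.
    apply: addr_ge0; first by rewrite mulr_ge0 ?exprn_ge0 ?divr_ge0 //; lra.
    by rewrite !mulr_ge0 ?powR_ge0 ?invr_ge0 //; lra.
  have M1 := M_ge1 n0.
  have logt1 : 1 <= logt by exact: log_factor_ge1.
  have [E [mE PE EP]] : exists E : set T, [/\ measurable E, (prob%:E <= P E)%E
      & forall w, E w -> pop_loss P Z L (betahat w) - pop_loss P Z L beta_star
        <= lam * (s * R0) + eps + 9 * sigma / M].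
    (* The chain is [pen_sum <= lam * l1norm] at [betal1 w], then l1 optimality against [beta_eps],
       then [l1norm beta_eps <= s * R0]. *)
    apply: core => //; apply: filterS2 l1min hatl1 => w /(_ beta_eps) minw hatw.
    have := pen_sum_le_l1norm (betal1 w) a0 lam0.
    have := ler_wpM2l lam0 (l1norm_le_l0norm beta_eps).
    have : lam * ((l0norm beta_eps)%:R * linfnorm beta_eps) <= lam * (s * R0).
      by rewrite ler_wpM2l // ler_wpM2l.
    by rewrite /pen_loss in hatw *; lra.
  exists E; split=> //; split=> // w /EP /le_trans; apply.
  rewrite powR_two_thirds -/M; apply: lasso_rate_le => //.
  + by rewrite c0.
  + by rewrite a0.
  + by rewrite lamE powR_two_thirds.
Qed.
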